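(* Let $\Gamma$ be a dicycle of even order $n\ge4$, with vertices $1,\dots,n$ and edges $(1,2),(2,3),\dots,(n-1,n),(n,1)$ (up to relabeling, starting from any vertex). Construct $\Gamma'$ from $\Gamma$ by performing a twin splitting on each of the vertices $1,3,5,\dots,n-1$ (every other vertex of the dicycle), and let $T$ be the set of $n$ vertices consisting of these split vertices together with their new copies. Construct $\Gamma''$ from $\Gamma'$ by adding a new vertex $v$ together with the edges $(v,t)$ and $(t,v)$ for every $t\in T$. Then $\Gamma'$ is a balanced digraph that is not normal, and $\Gamma''$ is a normal digraph.
   Context: Digraphs are finite, simple (no loops) and unweighted. The twin splitting of a vertex $w$ of a digraph $(V,E)$ adds a new vertex $w'$ (not adjacent to $w$) such that for all other vertices $u$, $(u,w')$ is an edge iff $(u,w)$ is an edge, and $(w',u)$ is an edge iff $(w,u)$ is an edge. The Laplacian is $L=D-A$ with $A$ the adjacency matrix and $D$ the diagonal matrix of out-degrees. A digraph is normal if $L$ is a normal matrix, and balanced if every vertex has in-degree equal to out-degree. *)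

(* Defs.v *)
From HB Require Import structures.
From mathcomp Require Import all_boot all_order all_algebra.
Set Implicit Arguments. Unset Strict Implicit. Unset Printing Implicit Defensive.
Import GRing.Theory Num.Theory.
Local Open Scope ring_scope.

Record digraph := Digraph {
  vertex :> finType;
  edge : rel vertex;
  edge_irr : irreflexive edge
}.

Definition outdeg (G : digraph) (x : G) : nat := #|[set y | edge x y]|.
Definition indeg (G : digraph) (x : G) : nat := #|[set y | edge y x]|.

Definition balanced (G : digraph) : Prop := forall x : G, indeg x = outdeg x.

(* Rows and columns are indexed by the enumeration [enum_val] of the vertices. *)
Definition adjmx (R : pzRingType) (G : digraph) : 'M[R]_#|G| :=
  \matrix_(i, j) (edge (enum_val i) (enum_val j))%:R.

Definition outdegmx (R : pzRingType) (G : digraph) : 'M[R]_#|G| :=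
  diag_mx (\row_i (outdeg (enum_val i))%:R).

Definition laplacian (R : pzRingType) (G : digraph) : 'M[R]_#|G| :=
  outdegmx R G - adjmx R G.

(* [normalmx] is only defined over a numClosedFieldType, so the Laplacian is
   regarded as a matrix over such a field. *)
Definition normal_digraph (C : numClosedFieldType) (G : digraph) : Prop :=
  laplacian C G \is normalmx.

(* [None] is the twin w' of w.  The vertices w and w' are not adjacent because
   w has no loop. *)
Definition twin_edge (G : digraph) (w : G) : rel (option G) := fun x y =>
  match x, y with
  | Some a, Some b => edge a b
  | Some a, None => edge a w
  | None, Some b => edge w b
  | None, None => false
  end.

Fact twin_edge_irr (G : digraph) (w : G) : irreflexive (twin_edge w).
Proof. by case=> [a|] //=; apply: edge_irr. Qed.

Definition twin_split (G : digraph) (w : G) : digraph :=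
  Digraph (twin_edge_irr w).

(* Splits the vertices of s one after the other, collecting in T the vertices
   that were split and their twins.  The old vertices of [twin_split w] are the
   [Some x], so s and T are transported along [Some].  The recursion is on the
   number k of splittings because the type of s changes at each step. *)
Fixpoint twin_splits_rec (k : nat) (G : digraph) (T : {set G}) (s : seq G) :
    {H : digraph & {set H}} :=
  match k, s with
  | k'.+1, w :: s' =>
      @twin_splits_rec k' (twin_split w)
        ([set Some x | x in T] :|: [set Some w; None]) (map Some s')
  | _, _ => existT (fun H : digraph => {set H}) G T
  end.

Definition twin_splits (G : digraph) (s : seq G) : {H : digraph & {set H}} :=
  twin_splits_rec (size s) set0 s.

Definition split_digraph (G : digraph) (s : seq G) : digraph :=
  projT1 (twin_splits s).

Definition split_vertices (G : digraph) (s : seq G) : {set split_digraph s} :=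
  projT2 (twin_splits s).

(* [None] is the added vertex. *)
Definition add_edge (G : digraph) (T : {set G}) : rel (option G) := fun x y =>
  match x, y with
  | Some a, Some b => edge a b
  | Some a, None => a \in T
  | None, Some b => b \in T
  | None, None => false
  end.

Fact add_edge_irr (G : digraph) (T : {set G}) : irreflexive (add_edge T).
Proof. by case=> [a|] //=; apply: edge_irr. Qed.

Definition add_vertex (G : digraph) (T : {set G}) : digraph :=
  Digraph (add_edge_irr T).

(* [lab i] is the vertex numbered i + 1 on the dicycle; [ordS] is the cyclic
   successor. *)
Definition dicycle_labeling (n : nat) (G : digraph) (lab : 'I_n -> G) : Prop :=
  bijective lab /\ forall i j, edge (lab i) (lab j) = (j == ordS i).

(* Main.v *)
(* Entrywise, L L^* = L^* L says that for all vertices x, y, with d the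
   out-degree and A the adjacency matrix,
   #common out-neighbours + (d x - d y) (A x y - A y x) = #common in-neighbours.
   The graph with all odd-numbered vertices split is a blow-up of the dicycle
   with fibres of sizes 2, 1, 2, 1, ...: two of its vertices have common
   neighbours only in the same fibre, and then equally many on both sides, so
   the second term alone, nonzero on each edge, obstructs normality.  Joining a
   vertex to all doubled fibres makes the out-degrees of the old vertices equal
   and adds edges symmetrically, which restores the identity. *)
Require Import Defs.
From HB Require Import structures.
From mathcomp Require Import all_boot all_order all_algebra.
From mathcomp Require Import ring zify.
Set Implicit Arguments. Unset Strict Implicit. Unset Printing Implicit Defensive.
Import GRing.Theory Num.Theory.

Lemma card_set_option (T : finType) (P : pred (option T)) :
  #|[set x | P x]| = P None + #|[set x | P (Some x)]|.
Proof.
rewrite (cardsD1 None) inE; congr (_ + _).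
rewrite -[RHS](card_imset _ (@Some_inj _)); apply: eq_card => -[x|].
  by rewrite mem_imset ?inE //; apply: Some_inj.
by rewrite !inE /=; apply/esym/negP => /imsetP[].
Qed.

Definition codeg (G : digraph) (x y : G) : nat :=
  #|[set z | edge x z && edge y z]|.
Definition coindeg (G : digraph) (x y : G) : nat :=
  #|[set z | edge z x && edge z y]|.

Section Normal.
Variables (C : numClosedFieldType) (G : digraph).
Local Open Scope ring_scope.

(** Indexed by vertices instead of ordinals, so that sums run over [G] itself. *)
Let l (x y : G) : C := (outdeg x)%:R *+ (x == y) - (edge x y)%:R.

Let sum_delta (x : G) (F : G -> C) : \sum_z (x == z)%:R * F z = F x.
Proof.
rewrite (bigD1 x) //= eqxx mul1r big1 ?addr0 // => z /negPf.
by rewrite eq_sym => ->; rewrite mul0r.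
Qed.

Let sum_out x y : \sum_z l x z * l y z
  = ((x == y) * (outdeg x * outdeg x))%:R + (codeg x y)%:R
    - (outdeg x * edge y x + outdeg y * edge x y)%:R.
Proof.
have -> : ((codeg x y)%:R : C) = \sum_z (edge x z && edge y z)%:R.
  by rewrite /codeg -sum1dep_card big_mkcond natr_sum; apply: eq_bigr => z _; case: ifP.
under [LHS]eq_bigr => z _.
  rewrite (_ : _ * _ = (x == z)%:R * ((outdeg x)%:R * l y z)
    - (y == z)%:R * ((outdeg y)%:R * (edge x z)%:R)
    + (edge x z && edge y z)%:R); last first.
    rewrite /l; do 2 case: (edge _ _) => /=; do 2 case: (_ == z) => /=; ring.
  over.
rewrite big_split sumrB !sum_delta /l eq_sym.
by case: eqP => [->|_]; rewrite /= ?mulr1n ?mulr0n; ring.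
Qed.

Let sum_in x y : \sum_z l z x * l z y
  = ((x == y) * (outdeg x * outdeg x))%:R + (coindeg x y)%:R
    - (outdeg x * edge x y + outdeg y * edge y x)%:R.
Proof.
have -> : ((coindeg x y)%:R : C) = \sum_z (edge z x && edge z y)%:R.
  by rewrite /coindeg -sum1dep_card big_mkcond natr_sum; apply: eq_bigr => z _; case: ifP.
under [LHS]eq_bigr => z _.
  rewrite (_ : _ * _ = (x == z)%:R * ((outdeg z)%:R * l z y)
    - (y == z)%:R * ((outdeg z)%:R * (edge z x)%:R)
    + (edge z x && edge z y)%:R); last first.
    rewrite /l ![z == _]eq_sym.
    do 2 case: (edge _ _) => /=; do 2 case: (_ == z) => /=; ring.
  over.
rewrite big_split sumrB !sum_delta /l.
by case: eqP => [->|_]; rewrite /= ?mulr1n ?mulr0n; ring.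
Qed.

(** Moving the subtracted terms across leaves an identity of casts, which descends to [nat] in
    characteristic zero. *)
Let natr_shift (m p q b c : nat) :
  m%:R + p%:R - b%:R = m%:R + q%:R - c%:R :> C <-> (p + c = q + b)%N.
Proof.
rewrite (rwP eqP) -subr_eq0 (_ : _ - _ = (p + c)%:R - (q + b)%:R); last ring.
by rewrite subr_eq0 eqr_nat -(rwP eqP).
Qed.

Let laplacianE i j : laplacian C G i j = l (enum_val i) (enum_val j).
Proof. by rewrite !mxE /l (inj_eq enum_val_inj). Qed.

(** Entries are integers, so the adjoint of the Laplacian is its transpose. *)
Let conj_l x y : (l x y)^* = l x y.
Proof. by rewrite rmorphB rmorphMn /= !conjC_nat. Qed.

(** The two matrix products have as entries the inner products of rows and of columns; the squared
    out-degrees on the diagonal cancel. *)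
Lemma normal_digraphP :
  normal_digraph C G <-> forall x y : G,
    (codeg x y + outdeg x * edge x y + outdeg y * edge y x
     = coindeg x y + outdeg x * edge y x + outdeg y * edge x y)%N.
Proof.
pose t x y := \sum_z l x z * l y z = \sum_z l z x * l z y.
have tP x y : t x y <->
    (codeg x y + outdeg x * edge x y + outdeg y * edge y x
     = coindeg x y + outdeg x * edge y x + outdeg y * edge x y)%N.
  by rewrite /t sum_out sum_in -!addnA; exact: natr_shift.
have mulE i j : (laplacian C G *m (map_mx Num.conj (laplacian C G)^T)) i j
    = \sum_z l (enum_val i) z * l (enum_val j) z.
  rewrite mxE [RHS](reindex _ (onW_bij _ (enum_val_bij G))) /=.
  by apply: eq_bigr => k _; rewrite laplacianE 2!mxE laplacianE conj_l.
have mulE' i j : ((map_mx Num.conj (laplacian C G)^T) *m laplacian C G) i j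
    = \sum_z l z (enum_val i) * l z (enum_val j).
  rewrite mxE [RHS](reindex _ (onW_bij _ (enum_val_bij G))) /=.
  by apply: eq_bigr => k _; rewrite laplacianE 2!mxE laplacianE conj_l.
split=> [/normalmxP e x y|e].
  apply/tP; have := congr1 (fun M : 'M_ _ => M (enum_rank x) (enum_rank y)) e.
  by rewrite mulE mulE' !enum_rankK.
by apply/normalmxP/matrixP => i j; rewrite mulE mulE'; apply/tP/e.
Qed.

End Normal.

(** The vertex type of the result depends on the recursion, so the graph is described by its
    projection [p] to [G]. Distinctness of [s] keeps fibres to at most two vertices. *)
Lemma twin_splits_rec_proj (k : nat) (G : digraph) (T : {set G}) (s : seq G) :
    k = size s -> uniq s ->
  let: existT H U := twin_splits_rec k T s in
  exists p : H -> G,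
    [/\ forall x y, edge x y = edge (p x) (p y),
        forall w, #|[set x | p x == w]| = (w \in s).+1
      & U = [set x | (p x \in T) || (p x \in s)]].
Proof.
elim: k G T s => [|k IH] G T [|w s] //=.
  move=> _ _; exists id; split=> // [w|].
    by rewrite (eq_card (B := pred1 w)) ?card1 // => x; rewrite !inE.
  by apply/setP => x; rewrite !inE orbF.
move=> [ek] /andP[w_s s_uniq]; set T1 := _ :|: _.
have := IH (twin_split w) T1 (map Some s); rewrite size_map.
rewrite (map_inj_uniq (@Some_inj _)) => /(_ ek s_uniq).
case: twin_splits_rec => H U [p [p_edge p_card ->]].
(* The twin [None] is sent to [w]; edges are respected because [w] has no loop. *)
exists (fun x => odflt w (p x)); split.
- by move=> x y; rewrite p_edge; case: (p x) (p y) => [a|] [b|] //=; rewrite edge_irr.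
- move=> u; have fibre : [set x | odflt w (p x) == u] =
      [set x | p x == Some u] :|: [set x | (p x == None) && (w == u)].
    by apply/setP => x; rewrite !inE; case: (p x) => [a|] //=; rewrite orbF.
  rewrite fibre inE eq_sym; case: eqP => [->|_] /=.
    (* Over [w] lie two singletons: [w] does not recur in [s], and its twin is never split. *)
    under [X in _ :|: X]eq_finset => x do rewrite andbT.
    rewrite cardsU !p_card !(mem_map (@Some_inj _)) (negPf w_s).
    rewrite (_ : _ :&: _ = set0) ?cards0 ?subn0.
      by case: mapP => [[]|].
    by apply/setP => x; rewrite !inE; case: (p x) => [a|] /=; rewrite ?andbF.
  rewrite (_ : [set x | _ && false] = set0); last by apply/setP => x; rewrite !inE andbF.
  by rewrite setU0 p_card (mem_map (@Some_inj _)).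
- apply/setP => x; rewrite !inE; case: (p x) => [a|] /=; last by rewrite !eqxx !orbT.
  rewrite (mem_map (@Some_inj _)) (mem_imset _ _ (@Some_inj _)) orbF.
  by rewrite orbA.
Qed.

Section DicycleBlowup.
Variables (n : nat) (H : digraph) (q : H -> 'I_n).
Hypotheses (n_ge4 : 4 <= n) (n_even : ~~ odd n).
Hypothesis q_edge : forall x y, edge x y = (q y == ordS (q x)).
Hypothesis q_card : forall i : 'I_n, #|[set x | q x == i]| = (~~ odd i).+1.

(** As [n] is even, parity also alternates across the step from [n - 1] to [0]. *)
Let odd_ordS (i : 'I_n) : odd (ordS i) = ~~ odd i.
Proof. by rewrite /= odd_mod //; apply: negbTE. Qed.

Let odd_ord_pred (i : 'I_n) : odd (ord_pred i) = ~~ odd i.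
Proof. by rewrite -{2}[i]ord_predK odd_ordS negbK. Qed.

Let q_edge_pred x y : edge x y = (q x == ord_pred (q y)).
Proof. by rewrite q_edge eq_sym (can2_eq (@ordSK n) (@ord_predK n)). Qed.

Let outdeg_blowup x : outdeg x = (odd (q x)).+1.
Proof.
rewrite /outdeg; under eq_finset => y do rewrite q_edge.
by rewrite q_card odd_ordS negbK.
Qed.

Let indeg_blowup x : indeg x = (odd (q x)).+1.
Proof.
rewrite /indeg; under eq_finset => y do rewrite q_edge_pred.
by rewrite q_card odd_ord_pred negbK.
Qed.

Let codeg_blowup (x y : H) : codeg x y = if q x == q y then (odd (q x)).+1 else 0.
Proof.
rewrite /codeg; under eq_finset => z do rewrite !q_edge.
case: eqP => [<-|q_neq].
  by under eq_finset => z do rewrite andbb; rewrite q_card odd_ordS negbK.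
apply: eq_card0 => z; rewrite inE; apply/negP => /andP[/eqP-> /eqP/ordS_inj].
exact: q_neq.
Qed.

(** The fibres just before and just after a given one have indices of equal parity, hence equal
    size. *)
Let coindeg_blowup (x y : H) : coindeg x y = codeg x y.
Proof.
rewrite codeg_blowup /coindeg; under eq_finset => z do rewrite !q_edge_pred.
case: eqP => [<-|q_neq].
  by under eq_finset => z do rewrite andbb; rewrite q_card odd_ord_pred negbK.
apply: eq_card0 => z; rewrite inE; apply/negP.
by move=> /andP[/eqP-> /eqP/(can_inj (@ord_predK n))].
Qed.

Lemma balanced_blowup : balanced H.
Proof. by move=> x; rewrite indeg_blowup outdeg_blowup. Qed.

Lemma not_normal_blowup (C : numClosedFieldType) : ~ normal_digraph C H.
Proof.
have q_surj i : exists x, q x = i.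
  have /card_gt0P[x] : 0 < #|[set x | q x == i]| by rewrite q_card.
  by rewrite inE => /eqP <-; exists x.
(* Over the indices 0 and 1 the out-degrees are 1 and 2, and the edge is one-way because the
   successor of 1 is 2, not 0. *)
have [[x qx] [y qy]] :
    (exists x, q x = Ordinal (ltnW (ltnW (ltnW n_ge4)))) /\
    (exists y, q y = Ordinal (ltnW (ltnW n_ge4))) by split; apply: q_surj.
move=> /normal_digraphP /(_ x y).
rewrite coindeg_blowup !outdeg_blowup !q_edge qx qy -!val_eqE /=.
by rewrite !modn_small ?(ltnW (ltnW n_ge4)) ?(ltnW n_ge4) //=; lia.
Qed.

Lemma normal_add_vertex_blowup (C : numClosedFieldType) (T : {set H}) :
  T = [set x | ~~ odd (q x)] -> normal_digraph C (add_vertex T).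
Proof.
move=> TE; have inT x : (x \in T) = ~~ odd (q x) by rewrite TE inE.
(* Vertices outside [T] already have out-degree 2; those in [T] have 1 and gain the edge to the new
   vertex. *)
have outdeg_old x : outdeg (Some x : add_vertex T) = 2.
  rewrite /outdeg card_set_option /= -/(outdeg x) outdeg_blowup inT.
  by case: odd.
have codeg_old (x y : H) : codeg (Some x : add_vertex T) (Some y)
    = (x \in T) && (y \in T) + codeg x y by exact: card_set_option.
have coindeg_old (x y : H) : coindeg (Some x : add_vertex T) (Some y)
    = (x \in T) && (y \in T) + codeg x y.
  by rewrite -coindeg_blowup; exact: card_set_option.
(* Neighbours of [y] have opposite parity, so they lie all in [T] or all outside it. *)
have T_out y : #|[set z in T | edge y z]| = if odd (q y) then 2 else 0.
  case: ifP => odd_y; [rewrite -[RHS]/((true).+1) -[in RHS]odd_y -outdeg_blowup|].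
    apply: eq_card => z; rewrite !inE inT q_edge; case: eqP => [->|_].
      by rewrite odd_ordS odd_y.
    by rewrite andbF.
  apply: eq_card0 => z; rewrite !inE inT q_edge andbC; case: eqP => // ->.
  by rewrite odd_ordS odd_y.
have T_in y : #|[set z in T | edge z y]| = if odd (q y) then 2 else 0.
  case: ifP => odd_y; [rewrite -[RHS]/((true).+1) -[in RHS]odd_y -indeg_blowup|].
    apply: eq_card => z; rewrite !inE inT q_edge_pred; case: eqP => [->|_].
      by rewrite odd_ord_pred odd_y.
    by rewrite andbF.
  apply: eq_card0 => z; rewrite !inE inT q_edge_pred andbC; case: eqP => // ->.
  by rewrite odd_ord_pred odd_y.
apply/normal_digraphP => -[x|] [y|] //=.
- by rewrite codeg_old coindeg_old !outdeg_old addnAC.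
(* Edges at the new vertex are symmetric, so the degree terms agree and only the neighbours in [T]
   remain to be counted. *)
- congr (_ + _ + _); rewrite /codeg /coindeg !card_set_option /= !andbF.
  under eq_finset => z do rewrite andbC.
  rewrite T_out; under eq_finset => z do rewrite andbC.
  by rewrite T_in.
- congr (_ + _ + _); rewrite /codeg /coindeg !card_set_option /=.
  by rewrite T_out T_in.
Qed.

End DicycleBlowup.

(* The list s enumerates, in any order, the vertices numbered 1, 3, ..., n - 1,
   which are the labels of the even indices 0, 2, ..., n - 2. *)
Theorem theorem3p5 (C : numClosedFieldType) (n : nat) (G : digraph)
    (lab : 'I_n -> G) (s : seq G) (n_ge4 : 4 <= n) (n_even : ~~ odd n)
    (G_dicycle : dicycle_labeling lab)
    (s_alternate : perm_eq s [seq lab i | i : 'I_n <- enum 'I_n & ~~ odd i]) :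
  let G' := split_digraph s in
  let T := split_vertices s in
  let G'' := add_vertex T in
  [/\ balanced G', ~ normal_digraph C G' & normal_digraph C G''].
Proof.
have [lab_bij lab_edge] := G_dicycle.
have lab_inj := bij_inj lab_bij; have [num labK numK] := lab_bij.
have s_uniq : uniq s.
  by rewrite (perm_uniq s_alternate) map_inj_uniq // filter_uniq // enum_uniq.
have mem_s w : (w \in s) = ~~ odd (num w).
  rewrite (perm_mem s_alternate) -{1}[w]numK mem_map // mem_filter mem_enum.
  by rewrite andbT.
rewrite /split_digraph /split_vertices.
move: (twin_splits_rec_proj set0 (erefl (size s)) s_uniq).
rewrite -/(twin_splits s); case: (twin_splits s) => H T [p [p_edge p_card TE]] /=.
pose q := num \o p.
have q_edge x y : edge x y = (q y == ordS (q x)).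
  by rewrite p_edge -[p x]numK -[p y]numK lab_edge.
have q_card i : #|[set x | q x == i]| = (~~ odd i).+1.
  under eq_finset => x do rewrite /q /= (can2_eq numK labK).
  by rewrite p_card mem_s labK.
split.
- exact: (balanced_blowup n_even q_edge q_card).
- exact: (not_normal_blowup n_ge4 n_even q_edge q_card).
- apply: (normal_add_vertex_blowup n_even q_edge q_card).
  by rewrite TE; apply/setP => x; rewrite !inE mem_s.
Qed.
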